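(* Let $a,b$ be complex numbers and define $g(n,1,a,b)$ by $\sum_{n\ge0}g(n,1,a,b)z^n=\frac{1}{\sqrt{(1-az)^2-4bz}}$. Let $dd_k^{(1)}(n,a,b)=\det\big(g(i+j+k,1,a,b)\big)_{i,j=0}^{n-1}$. Then for $n>0$ $$dd_0^{(1)}(n,a,b)=2^{n-1}b^{\binom n2}(a+b)^{\binom n2},\qquad dd_1^{(1)}(n,a,b)=2^{n-1}b^{\binom n2}(a+b)^{\binom n2}\big((a+b)^n+b^n\big),$$ $$dd_2^{(1)}(n,a,b)=dd_0^{(1)}(n,a,b)\Big(2b^n(a+b)^n+\sum_{j=1}^n\big((a+b)^j+b^j\big)^2b^{n-j}(a+b)^{n-j}\Big)=dd_0^{(1)}(n,a,b)\Big(\frac{(a+b)^{2n+1}-b^{2n+1}}{a}+(2n+1)b^n(a+b)^n\Big).$$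
   Context: The power series $\frac{1}{\sqrt{(1-az)^2-4bz}}$ is the formal power series with constant term $1$. The quotient $\frac{(a+b)^{2n+1}-b^{2n+1}}{a}$ denotes the polynomial $\sum_{j=0}^{2n}(a+b)^jb^{2n-j}$. *)

(* Defs.v *)
From mathcomp Require Import all_boot all_order all_algebra.
From mathcomp Require Import reals complex.

Set Implicit Arguments.
Unset Strict Implicit.
Unset Printing Implicit Defensive.

Import Order.TTheory GRing.Theory Num.Theory.
Local Open Scope ring_scope.

(* A formal power series is its sequence of coefficients; equality of series
   is pointwise equality [=1]. *)
Definition fps (K : Type) := nat -> K.

Definition fps_mul (K : comNzRingType) (F G : fps K) : fps K :=
  fun n => \sum_(i < n.+1) F i * G (n - i)%N.

Definition fps_of_poly (K : comNzRingType) (p : {poly K}) : fps K :=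
  fun n => p`_n.

Definition fps_one (K : comNzRingType) : fps K := fps_of_poly 1.

(* F is the series 1 / sqrt P with constant term 1: the reciprocal of a square
   root S of P.  See [fps_inv_sqrt_exists] and [fps_inv_sqrt_unique]. *)
Definition fps_inv_sqrt (K : comNzRingType) (P F : fps K) : Prop :=
  F 0%N = 1 /\
  exists S : fps K, fps_mul S S =1 P /\ fps_mul S F =1 fps_one K.

Definition hankel_det (K : comNzRingType) (g : fps K) (k n : nat) : K :=
  \det (\matrix_(i < n, j < n) g (i + j + k)%N).

Lemma fps_rec (T : Type) (f : seq T -> T) :
  exists u : nat -> T, forall n, u n = f (mkseq u n).
Proof.
pose l n := iter n (fun s => rcons s (f s)) [::].
exists (fun n => f (l n)) => n; congr f.
elim: n => [//|n IH]; rewrite mkseqS -IH //.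
Qed.

Lemma fps_mul_recl (K : comNzRingType) (F G : fps K) n :
  fps_mul F G n.+1 = F 0%N * G n.+1 + \sum_(i < n.+1) F i.+1 * G (n - i)%N.
Proof. by rewrite /fps_mul big_ord_recl subn0. Qed.

Lemma fps_sqr_rec (K : comNzRingType) (F : fps K) n :
  fps_mul F F n.+1 = F 0%N * F n.+1 *+ 2 + \sum_(i < n) F i.+1 * F (n - i)%N.
Proof.
rewrite fps_mul_recl big_ord_recr /= subnn (mulrC (F n.+1)) mulr2n.
by rewrite addrA addrAC.
Qed.

Lemma fps_inv_sqrt_exists (K : numFieldType) (P : fps K) :
  P 0%N = 1 -> exists F, fps_inv_sqrt P F.
Proof.
move=> P0.
have [S HS] := fps_rec (fun s => if size s is n.+1 then
  (P n.+1 - \sum_(i < n) nth 0 s i.+1 * nth 0 s (n - i)%N) / 2 else 1 : K).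
have S0 : S 0%N = 1 by rewrite HS.
have [F HF] := fps_rec (fun s => if size s is n.+1 then
  - \sum_(i < n.+1) S i.+1 * nth 0 s (n - i)%N else 1 : K).
have F0 : F 0%N = 1 by rewrite HF.
exists F; split=> //; exists S; split=> -[|n].
- by rewrite /fps_mul big_ord1 S0 mulr1 P0.
- rewrite fps_sqr_rec S0 mul1r HS size_mkseq -[X in X + _]mulr_natr.
  rewrite divfK ?pnatr_eq0 //.
  under eq_bigr => i _ do rewrite !nth_mkseq ?ltnS ?leq_subr //.
  by rewrite subrK.
- by rewrite /fps_mul big_ord1 S0 F0 mulr1 /fps_one /fps_of_poly coef1.
- rewrite fps_mul_recl S0 mul1r HF size_mkseq.
  under eq_bigr => i _ do rewrite nth_mkseq ?ltnS ?leq_subr //.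
  by rewrite addNr /fps_one /fps_of_poly coef1.
Qed.

Lemma fps_inv_sqrt_unique (K : numFieldType) (P F F' : fps K) :
  fps_inv_sqrt P F -> fps_inv_sqrt P F' -> F =1 F'.
Proof.
move=> [F0 [S [SS SF]]] [F'0 [S' [SS' SF']]].
have S0 : S 0%N = 1.
  by have := SF 0%N; rewrite /fps_mul big_ord1 F0 mulr1 /fps_one /fps_of_poly coef1.
have S'0 : S' 0%N = 1.
  by have := SF' 0%N; rewrite /fps_mul big_ord1 F'0 mulr1 /fps_one /fps_of_poly coef1.
have eS : S =1 S'.
  elim/ltn_ind=> -[|n] IH; first by rewrite S0.
  have := SS n.+1; rewrite -SS' !fps_sqr_rec S0 S'0 !mul1r.
  under eq_bigr => i _ do rewrite !IH ?ltnS ?leq_subr //.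
  by move/addIr/eqP; rewrite -subr_eq0 -mulrnBl mulrn_eq0 /= subr_eq0 => /eqP.
elim/ltn_ind=> -[|n] IH; first by rewrite F0.
have := SF n.+1; rewrite -SF' !fps_mul_recl S0 S'0 !mul1r.
under eq_bigr => i _ do rewrite eS IH ?ltnS ?leq_subr //.
by move/addIr.
Qed.

(* Main.v *)
From HB Require Import structures.
Require Import Defs.
From mathcomp Require Import all_boot all_order all_algebra.
From mathcomp Require Import boolp reals complex ring zify.

(* Put c = a + b, s = b + c and t = b c, so that the radicand is
   (1 - s z)^2 - 4 t z^2.  If U = z (1 + s U + t U^2), then 1 - s z - 2 t z U is
   the square root, and A(n, k) = [z^n] g U^k obeys the recurrence of the Jacobi
   matrix J with diagonal s, superdiagonal 1 and subdiagonal 2 t, t, t, ...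
   Hence the Hankel matrix shifted by m factors as A J^m D A^T, where A is
   unitriangular, D is diagonal and J^m is truncated to size n.  The determinant
   Q_n of the truncated J satisfies a three-term recurrence, solved by
   c^n + b^n.  The truncated J^2 is the square of the truncated J plus a single
   corner entry, so its determinant X_n satisfies X_n = Q_n^2 + t X_{n-1} for
   n >= 2. *)

Set Implicit Arguments.
Unset Strict Implicit.
Unset Printing Implicit Defensive.

Import Order.TTheory GRing.Theory Num.Theory.
Local Open Scope ring_scope.

(** * Determinants of leading truncations of an infinite matrix *)

Section Corner.
Variable K : comNzRingType.
Implicit Types M : nat -> nat -> K.

Definition nmx M n := \matrix_(i < n, j < n) M i j.

Lemma nmx_minor_max M n : row' ord_max (col' ord_max (nmx M n.+1)) = nmx M n.
Proof. by apply/matrixP=> i j; rewrite !mxE !lift_max. Qed.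

(** The determinant is affine in the bottom right entry, and the cofactor of that entry is the
    truncation of size [n]. *)
Lemma det_nmx_corner M M' x n :
    (forall i j : 'I_n.+1,
       M' i j = M i j + x *+ ((i == n :> nat) && (j == n :> nat))) ->
  \det (nmx M' n.+1) = \det (nmx M n.+1) + x * \det (nmx M n).
Proof.
move=> eqM'.
rewrite (expand_det_row _ ord_max) [in RHS](expand_det_row _ ord_max).
rewrite !big_ord_recr /= -addrA; congr (_ + _).
  apply: eq_bigr => i _; rewrite !mxE eqM' /= (ltn_eqF (ltn_ord i)) andbF mulr0n addr0.
  congr (_ * _); rewrite /cofactor; congr (_ * \det _).
  apply/matrixP=> j k; rewrite !mxE eqM' lift_max (ltn_eqF (ltn_ord j)) /=.
  by rewrite mulr0n addr0.
rewrite !mxE eqM' /= !eqxx mulr1n mulrDl; congr (_ * _ + _ * _); last first.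
  rewrite /cofactor /= addnn -signr_odd odd_double mul1r -(nmx_minor_max M).
  congr (\det _); apply/matrixP=> j k; rewrite !mxE eqM' !lift_max (ltn_eqF (ltn_ord j)) /=.
  by rewrite mulr0n addr0.
rewrite /cofactor; congr (_ * \det _).
apply/matrixP=> j k; rewrite !mxE eqM' !lift_max (ltn_eqF (ltn_ord j)) /=.
by rewrite mulr0n addr0.
Qed.

Lemma det_nmx_tridiag M n :
    (forall j, (j < n)%N -> M n.+1 j = 0 /\ M j n.+1 = 0) ->
  \det (nmx M n.+2) = M n.+1 n.+1 * \det (nmx M n.+1)
                      - M n n.+1 * M n.+1 n * \det (nmx M n).
Proof.
move=> M0; rewrite (expand_det_row _ ord_max) !big_ord_recr /= big1 ?add0r.
  rewrite addrC; congr (_ + _).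
    rewrite !mxE /cofactor nmx_minor_max /= addnn -signr_odd odd_double.
    by rewrite mul1r.
  rewrite !mxE /= /cofactor addSn addnn -signr_odd /= odd_double mulN1r.
  (* In the minor left by the entry [M n.+1 n], the last column has [M n n.+1] as its only possibly
     nonzero entry, so a second expansion reaches the truncation of size [n]. *)
  rewrite (expand_det_col _ ord_max) big_ord_recr /= big1 ?add0r => [|i _].
    rewrite !mxE lift_max /cofactor /= addnn -signr_odd odd_double mul1r.
    rewrite mulrN mulrA [M n.+1 n * _]mulrC {1}/bump leqnn.
    congr (- (_ * \det _)).
    apply/matrixP=> j k; rewrite !mxE !lift_max /=.
    by rewrite /bump (leqNgt n k) ltn_ord !add0n leqNgt ltn_ord.
  rewrite !mxE lift_max /= /bump leqnn /=.
  by rewrite (proj2 (M0 _ _)) ?mul0r.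
by move=> i _; rewrite !mxE /= (proj1 (M0 _ _)) ?mul0r.
Qed.
End Corner.

(** * Jacobi matrices and the Hankel determinants of their moments *)

Section Jacobi.
Variables (K : comNzRingType) (sigma tau : nat -> K).

Definition jacobi i j : K :=
  (j == i.+1)%:R + sigma i *+ (j == i) + tau j *+ (i == j.+1).

(** This is row 0 of the [n]-th power of the Jacobi matrix, or equivalently the weighted count of
    Motzkin paths of length [n] from height 0 to height [k]. *)
Fixpoint jcoef n k : K :=
  if n is n'.+1 then
    (if k is k'.+1 then jcoef n' k' else 0)
    + sigma k * jcoef n' k + tau k * jcoef n' k.+1
  else (k == 0)%:R.

Definition jnorm k : K := \prod_(i < k) tau i.

(** For [i < n] the [n.+1] summands already give the exact entry of $J^2$, since row [i] of $J$
    vanishes beyond column [i.+1]. *)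
Definition jacobi2 n i j : K := \sum_(r < n.+1) jacobi i r * jacobi r j.

Lemma jcoef_gt n k : (n < k)%N -> jcoef n k = 0.
Proof.
elim: n k => [|n IHn] [|k] //= ltnk.
by rewrite !IHn ?mulr0 ?addr0 //; lia.
Qed.

Lemma jcoef_diag n : jcoef n n = 1.
Proof.
by elim: n => //= n ->; rewrite !jcoef_gt ?mulr0 ?addr0 //; lia.
Qed.

Lemma sum_delta (f : nat -> K) N k :
  (forall l, (N <= l)%N -> f l = 0) ->
  \sum_(l < N) f l *+ (l == k :> nat) = f k.
Proof.
move=> f0; have [ltkN | leNk] := ltnP k N.
  rewrite (bigD1 (Ordinal ltkN)) //= eqxx mulr1n big1 ?addr0 // => l.
  by rewrite -val_eqE /= => /negPf->.
by rewrite f0 // big1 // => l _; rewrite ltn_eqF // (leq_trans _ leNk).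
Qed.

(** Multiplication by $J$ shifts the rows of $A$. Any [N > n] will do, since row [n] of $A$ vanishes
    beyond column [n]. *)
Lemma jcoefS n k N : (n < N)%N ->
  jcoef n.+1 k = \sum_(l < N) jcoef n l * jacobi l k.
Proof.
move=> ltnN; have f0 l : (N <= l)%N -> jcoef n l = 0.
  by move=> leNl; rewrite jcoef_gt // (leq_trans ltnN).
rewrite /jacobi; under eq_bigr => l _ do
  rewrite !mulrDr !mulrnAr mulr1.
rewrite !big_split /=; congr (_ + _ + _).
- case: k => [|k]; first by rewrite big1.
  under eq_bigr => l _ do rewrite eqSS eq_sym.
  by rewrite sum_delta.
- under eq_bigr => l _ do rewrite eq_sym.
  rewrite (@sum_delta (fun l => jcoef n l * sigma l)) 1?mulrC // => l /f0->.
  by rewrite mul0r.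
rewrite (@sum_delta (fun l => jcoef n l * tau k)) 1?mulrC // => l /f0->.
by rewrite mul0r.
Qed.

(** The weights [jnorm] satisfy [jnorm k.+1 = jnorm k * tau k], which is exactly what makes $J D$
    symmetric. *)
Lemma jacobi_sym i j : jacobi i j * jnorm j = jacobi j i * jnorm i.
Proof.
rewrite /jacobi; case: (ltngtP i j) => [ltij | ltji | ->] //.
- rewrite (ltn_eqF (leq_trans ltij (leqnSn j))) !mulr0n !addr0 add0r.
  rewrite ?(ltn_eqF (leq_trans ltij (leqnSn j))) ?mulr0n ?add0r.
  case: eqP => [->|_]; last by rewrite !mulr0n !mul0r.
  by rewrite mulr1n mul1r /jnorm big_ord_recr mulrC.
- rewrite (ltn_eqF (leq_trans ltji (leqnSn i))) !mulr0n !addr0 add0r.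
  rewrite ?(ltn_eqF (leq_trans ltji (leqnSn i))) ?mulr0n ?add0r.
  case: eqP => [->|_]; last by rewrite !mulr0n !mul0r.
  by rewrite mulr1n mul1r /jnorm big_ord_recr mulrC.
Qed.

(** By symmetry of $J D$, a factor $J$ can be moved from row [i] to row [j]; repeating this brings
    [i] down to 0. *)
Lemma jcoef_gram i j n : (j < n)%N ->
  \sum_(k < n) jcoef i k * jnorm k * jcoef j k = jcoef (i + j) 0.
Proof.
move=> ltjn; transitivity (\sum_(k < n + i) jcoef i k * jnorm k * jcoef j k).
  (* The range is widened first because the second index grows up to [i + j] in the induction; the
     added terms vanish. *)
  rewrite big_split_ord /= [X in _ + X]big1 ?addr0 // => k _.
  by rewrite [jcoef j _]jcoef_gt ?mulr0 // (leq_trans ltjn) ?leq_addr.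
have: (i + j < n + i)%N by rewrite addnC ltn_add2r.
elim: i (n + i)%N j {ltjn} => [|i IHi] N j ltN.
  rewrite -[RHS](@sum_delta (jcoef j) N) => [|l leNl]; last first.
    by rewrite jcoef_gt // (leq_trans _ leNl).
  apply: eq_bigr => -[[|k] ltk] _ /=; last by rewrite !mul0r mulr0n.
  by rewrite /jnorm big_ord0 !mul1r.
rewrite addSnnS -(IHi N) ?addnS //.
have [ltiN ltjN] : (i < N)%N /\ (j < N)%N by lia.
under eq_bigr => k _ do rewrite (jcoefS _ ltiN) !mulr_suml.
under [RHS]eq_bigr => k _ do rewrite (jcoefS _ ltjN) mulr_sumr.
rewrite exchange_big /=; apply: eq_bigr => k _; apply: eq_bigr => l _.
by rewrite -[_ * jacobi _ _ * _]mulrA jacobi_sym; ring.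
Qed.

Lemma det_jcoef n : \det (nmx jcoef n) = 1.
Proof.
rewrite det_trig ?big1 // => [i _|]; first by rewrite mxE jcoef_diag.
by apply/is_trig_mxP=> i j ltij; rewrite mxE jcoef_gt.
Qed.

(** [M] plays the role of $J^m$: the hypothesis says that it carries the first [n] rows of $A$ to
    the rows shifted by [m]. *)
Lemma det_hankel_factor m n (M : nat -> nat -> K) :
    (forall i k, (i < n)%N -> jcoef (i + m) k = \sum_(l < n) jcoef i l * M l k) ->
  hankel_det (jcoef^~ 0) m n = \det (nmx M n) * \prod_(k < n) jnorm k.
Proof.
move=> Mdef; rewrite /hankel_det.
have ->: \matrix_(i < n, j < n) jcoef (i + j + m) 0 =
    nmx jcoef n *m nmx M n *m diag_mx (\row_k jnorm k) *m (nmx jcoef n)^T.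
  apply/matrixP=> i j; rewrite !mxE addnAC -(@jcoef_gram _ _ n) //.
  apply: eq_bigr => k _; rewrite mul_mx_diag !mxE Mdef //.
  by congr (_ * _ * _); apply: eq_bigr => l _; rewrite !mxE.
rewrite !det_mulmx det_tr det_jcoef mul1r mulr1 det_diag.
by congr (_ * _); apply: eq_bigr => k _; rewrite mxE.
Qed.

Lemma hankel_jcoef0 n : hankel_det (jcoef^~ 0) 0 n = \prod_(k < n) jnorm k.
Proof.
rewrite (@det_hankel_factor _ _ (fun l k => (l == k)%:R)) => [|i k ltin].
  have ->: nmx (fun l k => (l == k)%:R) n = 1%:M :> 'M[K]_n.
    by apply/matrixP=> i j; rewrite !mxE.
  by rewrite det1 mul1r.
rewrite addn0 -[LHS](@sum_delta (jcoef i) n) => [|l lenl]; last first.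
  by rewrite jcoef_gt // (leq_trans ltin).
by apply: eq_bigr => l _; rewrite mulr_natr.
Qed.

Lemma hankel_jcoef1 n :
  hankel_det (jcoef^~ 0) 1 n = \det (nmx jacobi n) * \prod_(k < n) jnorm k.
Proof. by apply: det_hankel_factor => i k ltin; rewrite addn1 -jcoefS. Qed.

Lemma hankel_jcoef2 n :
  hankel_det (jcoef^~ 0) 2 n = \det (nmx (jacobi2 n) n) * \prod_(k < n) jnorm k.
Proof.
apply: det_hankel_factor => i k ltin; rewrite addn2 (@jcoefS _ _ n.+1) //.
under eq_bigr => r _ do rewrite (@jcoefS _ _ n) // mulr_suml.
rewrite exchange_big; apply: eq_bigr => l _; rewrite mulr_sumr.
by apply: eq_bigr => r _; rewrite mulrA.
Qed.

Lemma jacobi_far i j : (i.+1 < j)%N || (j.+1 < i)%N -> jacobi i j = 0.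
Proof.
move=> far; rewrite /jacobi.
have [] := (j =P i.+1, j =P i); case=> [|_]; first by lia.
case=> [|_]; first by lia.
by case: (i =P j.+1) => [|_]; [lia | rewrite !addr0].
Qed.

Lemma det_jacobi_rec n :
  \det (nmx jacobi n.+2) =
  sigma n.+1 * \det (nmx jacobi n.+1) - tau n * \det (nmx jacobi n).
Proof.
rewrite det_nmx_tridiag => [|j ltjn].
  rewrite /jacobi !eqxx ?(ltn_eqF (ltnSn _)) ?(ltn_eqF (leqW (ltnSn _))).
  rewrite ?(gtn_eqF (ltnSn _)) ?(gtn_eqF (leqW (ltnSn _))).
  by rewrite !mulr0n !mulr1n !(addr0, add0r) mul1r.
by rewrite !jacobi_far ?ltnS ?ltjn ?orbT.
Qed.

(* Truncating the square of the Jacobi matrix and squaring its truncation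
   differ only in the bottom right entry. *)
Lemma det_jacobi2_rec n :
  \det (nmx (jacobi2 n.+1) n.+1) =
  \det (nmx jacobi n.+1) ^+ 2 + tau n * \det (nmx (jacobi2 n) n).
Proof.
rewrite (@det_nmx_corner _ (jacobi2 n) _ (tau n)) => [|i j].
  congr (_ + _); rewrite expr2 -det_mulmx; congr (\det _).
  by apply/matrixP=> i j; rewrite !mxE; apply: eq_bigr => r _; rewrite !mxE.
rewrite {1}/jacobi2 big_ord_recr /=; congr (_ + _).
rewrite /jacobi !eqSS (gtn_eqF (ltn_ord i)) (ltn_eqF (ltn_ord j)).
rewrite ?(ltn_eqF (leqW (ltn_ord i))) ?(ltn_eqF (leqW (ltn_ord j))).
rewrite !mulr0n !addr0 add0r [n == i]eq_sym [n == j]eq_sym.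
by case: eqP => [_|_] /=; case: eqP => [->|_] /=; rewrite ?mulr0n ?mul0r ?mulr0 ?mul1r.
Qed.

End Jacobi.

(** * The commutative ring of formal power series *)

Section SeriesRing.
Variable K : comNzRingType.
Implicit Types F G H : fps K.

HB.instance Definition _ := gen_eqMixin (fps K).
HB.instance Definition _ := gen_choiceMixin (fps K).

Definition fps_add F G : fps K := fun n => F n + G n.
Definition fps_opp F : fps K := fun n => - F n.
Definition fps_zero : fps K := fun=> 0.

Lemma fps_addA : associative fps_add.
Proof. by move=> F G H; apply/funext=> n; apply: addrA. Qed.

Lemma fps_addC : commutative fps_add.
Proof. by move=> F G; apply/funext=> n; apply: addrC. Qed.

Lemma fps_add0 : left_id fps_zero fps_add.
Proof. by move=> F; apply/funext=> n; apply: add0r. Qed.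

Lemma fps_addN : left_inverse fps_zero fps_opp fps_add.
Proof. by move=> F; apply/funext=> n; apply: addNr. Qed.

HB.instance Definition _ :=
  GRing.isZmodule.Build (fps K) fps_addA fps_addC fps_add0 fps_addN.

Definition fps_trunc F n := \poly_(i < n) F i.

(** Low coefficients of a product depend only on truncations, so commutativity and associativity are
    inherited from polynomials. *)
Lemma fps_mul_trunc F G n k : (k < n)%N ->
  fps_mul F G k = (fps_trunc F n * fps_trunc G n)`_k.
Proof.
move=> ltkn; rewrite coefM; apply: eq_bigr => i _; rewrite !coef_poly.
by rewrite !(leq_ltn_trans _ ltkn) ?leq_subr // -ltnS.
Qed.

Lemma fps_mulC : commutative (@fps_mul K).
Proof.
by move=> F G; apply/funext=> n; rewrite !(fps_mul_trunc _ _ (ltnSn n)) mulrC.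
Qed.

Lemma fps_mulA : associative (@fps_mul K).
Proof.
have mul3 F G H n : fps_mul (fps_mul F G) H n =
    (fps_trunc F n.+1 * fps_trunc G n.+1 * fps_trunc H n.+1)`_n.
  rewrite coefM; apply: eq_bigr => i _; rewrite coef_poly ltnS leq_subr.
  by congr (_ * _); apply: fps_mul_trunc.
move=> F G H; rewrite [LHS]fps_mulC; apply/funext=> n.
by rewrite !mul3 [in LHS]mulrC mulrA.
Qed.

Lemma fps_mul1 : left_id (fps_one K) (@fps_mul K).
Proof.
move=> F; apply/funext=> n; rewrite /fps_mul big_ord_recl subn0.
rewrite /fps_one /fps_of_poly coef1 mul1r big1 ?addr0 // => i _.
by rewrite coef1 mul0r.
Qed.

Lemma fps_mulDl : left_distributive (@fps_mul K) fps_add.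
Proof.
move=> F G H; apply/funext=> n; rewrite /fps_add /fps_mul -big_split.
by apply: eq_bigr => i _; rewrite mulrDl.
Qed.

Lemma fps_one_neq0 : fps_one K != 0.
Proof.
apply/eqP=> /(congr1 (fun F : fps K => F 0)).
by rewrite /fps_one /fps_of_poly coef1; apply/eqP/oner_neq0.
Qed.

HB.instance Definition _ := GRing.Zmodule_isComNzRing.Build (fps K)
  fps_mulA fps_mulC fps_mul1 fps_mulDl fps_one_neq0.

Lemma fps_of_poly_is_zmod_morphism : zmod_morphism (@fps_of_poly K).
Proof. by move=> p q; apply/funext=> n; apply: coefB. Qed.

Lemma fps_of_poly_is_monoid_morphism : monoid_morphism (@fps_of_poly K).
Proof. by split=> // p q; apply/funext=> n; apply: coefM. Qed.

HB.instance Definition _ := GRing.isZmodMorphism.Build {poly K} (fps K)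
  (@fps_of_poly K) fps_of_poly_is_zmod_morphism.
HB.instance Definition _ := GRing.isMonoidMorphism.Build {poly K} (fps K)
  (@fps_of_poly K) fps_of_poly_is_monoid_morphism.

Lemma fpsD F G n : (F + G) n = F n + G n. Proof. by []. Qed.

Lemma fpsM0 F G : (F * G) 0 = F 0 * G 0.
Proof. by rewrite /GRing.mul /= /fps_mul big_ord1. Qed.

Lemma fps_coefC (x : K) F n : (fps_of_poly x%:P * F) n = x * F n.
Proof.
rewrite {1}/GRing.mul /= /fps_mul big_ord_recl subn0 /fps_of_poly coefC.
by rewrite big1 ?addr0 // => i _; rewrite coefC mul0r.
Qed.

Lemma fps_coefX F n : (fps_of_poly 'X * F) n = if n is m.+1 then F m else 0.
Proof.
rewrite {1}/GRing.mul /= /fps_mul big_ord_recl /fps_of_poly coefX mul0r add0r.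
case: n => [|n]; first by rewrite big_ord0.
rewrite big_ord_recl coefX mul1r subSS subn0.
by rewrite big1 ?addr0 // => i _; rewrite coefX mul0r.
Qed.

End SeriesRing.

(** * The reciprocal square root as a moment series *)

Local Notation "c %:S" := (fps_of_poly c%:P) (at level 2, format "c %:S").
Local Notation Z := (fps_of_poly 'X).

(** The factor [Z] makes each coefficient of the right side depend on earlier coefficients of [U]
    only, so the equation is a recursive definition. *)
Lemma motzkin_series_exists (K : comNzRingType) (s t : K) :
  exists U : fps K, U = Z * (1 + s%:S * U + t%:S * U ^+ 2).
Proof.
have [U defU] := fps_rec (fun u => if size u is n.+1 then
  (n == 0)%:R + s * nth 0 u n + t * \sum_(i < n.+1) nth 0 u i * nth 0 u (n - i)
  else 0 : K).
exists U; apply/funext=> -[|n]; first by rewrite fps_coefX defU.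
rewrite fps_coefX defU size_mkseq !fpsD !fps_coefC nth_mkseq //.
congr (_ + _ + t * _); first by rewrite -coef1.
apply: eq_bigr => i _.
by rewrite !nth_mkseq ?ltn_ord // ltnS leq_subr.
Qed.

Definition tau2 (K : comNzRingType) (t : K) i := if i is 0 then 2 * t else t.

Lemma jcoef_inv_sqrt (K : numFieldType) (s t : K) (g : fps K) :
    fps_inv_sqrt (fps_of_poly ((1 - s%:P * 'X) ^+ 2 - (4 * t)%:P * 'X ^+ 2)) g ->
  g =1 (jcoef (fun=> s) (tau2 t))^~ 0.
Proof.
move=> hg; have [g0 [S [/funext SS /funext Sg]]] := hg.
have {}SS : S * S = fps_of_poly ((1 - s%:P * 'X) ^+ 2 - (4 * t)%:P * 'X ^+ 2).
  exact: SS.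
have {}Sg : S * g = 1 by [].
have [U defU] := motzkin_series_exists s t.
pose V : fps K := 1 - s%:S * Z - 2 * t%:S * Z * U.
have VV : V * V = S * S.
  (* The difference [S * S - V * V] is $4tz$ times $U - z(1 + sU + tU^2)$, which is zero. *)
  have /eqP defU0 := defU; rewrite -subr_eq0 in defU0.
  rewrite SS -[RHS]subr0 -(mulr0 (4 * t%:S * Z)) -(eqP defU0) /V.
  by rewrite !rmorphB !rmorphXn !rmorphB /= !rmorphM /=; ring.
have V0 : V 0 = 1.
  have ->: V = 1 - Z * (s%:S + 2 * t%:S * U) by rewrite /V; ring.
  by rewrite fpsD -mulrN fps_coefX addr0 -[LHS]/((1 : {poly K})`_0) coef1.
(* [V * g ^+ 2] is another reciprocal square root, so [V] is the inverse of [g]. *)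
have Vg : V * g = 1.
  have VVgg : V * (V * g ^+ 2) = 1.
    by rewrite mulrA VV -(expr1n _ 2) -Sg; ring.
  have/(fps_inv_sqrt_unique hg)/funext eg: fps_inv_sqrt
      (fps_of_poly ((1 - s%:P * 'X) ^+ 2 - (4 * t)%:P * 'X ^+ 2)) (V * g ^+ 2).
    split; first by rewrite expr2 !fpsM0 V0 g0 !mulr1.
    exists V; split=> n; rewrite -[fps_mul _ _]/(V * _).
      by rewrite VV SS.
    by rewrite VVgg.
  by rewrite {1}eg VVgg.
have U0 : U 0 = 0 by rewrite defU fps_coefX.
suffices coefgU n k : jcoef (fun=> s) (tau2 t) n k = (g * U ^+ k) n.
  by move=> n; rewrite coefgU mulr1.
elim: n k => [|n IHn] k /=.
  case: k => [|k]; first by rewrite mulr1 g0.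
  by rewrite exprS !fpsM0 U0 mul0r mulr0.
rewrite !IHn; case: k => [|k] /=.
  (* Column 0 comes from [V * g = 1], whose term $2tzUg$ is the origin of the doubled first weight
     in [tau2]; the other columns come from the equation of [U] multiplied by $g U^k$. *)
  have eqg : g * U ^+ 0 = 1 + 
      Z * (s%:S * (g * U ^+ 0) + (2 * t)%:S * (g * U ^+ 1)).
    rewrite -[X in X + _]Vg /V !rmorphM; ring.
  rewrite [in RHS]eqg fpsD fps_coefX !fpsD !fps_coefC add0r.
  by rewrite -[(1 : fps K) _]/((1 : {poly K})`_n.+1) coef1 add0r.
have eqg : g * U ^+ k.+1 =
   Z * (g * U ^+ k + s%:S * (g * U ^+ k.+1) + t%:S * (g * U ^+ k.+2)).
  rewrite !exprS {1}defU; ring.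
by rewrite [in RHS]eqg fps_coefX !fpsD !fps_coefC IHn.
Qed.

(** * Closed forms of the determinants *)

Section ClosedForms.
Variables (K : comNzRingType) (b c : K).
Let J := jacobi (fun=> b + c) (tau2 (b * c)).
Let J2 := jacobi2 (fun=> b + c) (tau2 (b * c)).

Lemma prod_jnorm_tau2 (t : K) n :
  \prod_(k < n.+1) jnorm (tau2 t) k = 2 ^+ n * t ^+ 'C(n.+1, 2).
Proof.
have normS k : jnorm (tau2 t) k.+1 = 2 * t ^+ k.+1.
  elim: k => [|k IHk]; first by rewrite /jnorm big_ord1.
  by rewrite /jnorm big_ord_recr /= -/(jnorm _ _) IHk [t ^+ k.+2]exprSr mulrA.
elim: n => [|n IHn]; first by rewrite big_ord1 /jnorm big_ord0 mulr1.
rewrite big_ord_recr /= IHn normS [in RHS]binS bin1 exprD [2 ^+ n.+1]exprS.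
by ring.
Qed.

(** The recurrence has characteristic roots [b] and [c]. At size 2 the doubled weight compensates
    for the empty determinant being 1 instead of $c^0 + b^0 = 2$. *)
Lemma det_jacobi_tau2 n : \det (nmx J n.+1) = c ^+ n.+1 + b ^+ n.+1.
Proof.
have Q1 : \det (nmx J 1) = c + b.
  by rewrite det_mx11 mxE /J /jacobi !addr0 add0r mulr1n addrC.
elim/ltn_ind: n => -[_|[_|n IHn]]; rewrite ?Q1 // /J det_jacobi_rec -/J.
  by rewrite Q1 det_mx00 /=; ring.
by rewrite !IHn //= !exprS; ring.
Qed.

(** Unrolling $X_n = Q_n^2 + t X_{n-1}$ gives the sum; the term outside it stems from the doubled
    weight in $X_1 = Q_1^2 + 2t$. *)
Lemma det_jacobi2_tau2 n :
  \det (nmx (J2 n.+1) n.+1) =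
  2 * b ^+ n.+1 * c ^+ n.+1 + \sum_(1 <= j < n.+2)
     (c ^+ j + b ^+ j) ^+ 2 * b ^+ (n.+1 - j) * c ^+ (n.+1 - j).
Proof.
elim: n => [|n IHn]; rewrite /J2 det_jacobi2_rec -/J -/J2 det_jacobi_tau2.
  by rewrite det_mx00 big_nat1 subnn /=; ring.
rewrite IHn [in RHS]big_nat_recr //= subnn !expr0 !mulr1 [LHS]addrC mulrDr [RHS]addrA.
congr (_ + _ + _); first by rewrite !exprS; ring.
rewrite mulr_sumr; apply: eq_big_nat => j /andP[_ ltjn].
by rewrite [(n.+2 - j)%N]subSn // !exprS; ring.
Qed.

(** From [n] to [n.+1], both sides are multiplied by $bc$ and gain $(c^{n+1} + b^{n+1})^2$. On the
    right, its squares are the two end terms of the sum and its cross term raises $2n+1$ to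
    $2n+3$. *)
Lemma sum_sqr_power_sums n :
  2 * b ^+ n * c ^+ n + \sum_(1 <= j < n.+1)
     (c ^+ j + b ^+ j) ^+ 2 * b ^+ (n - j) * c ^+ (n - j) =
  \sum_(0 <= j < (2 * n).+1) c ^+ j * b ^+ (2 * n - j)
    + (2 * n + 1)%:R * b ^+ n * c ^+ n.
Proof.
elim: n => [|n IHn].
  by rewrite muln0 big_nat1 big_geq // !expr0; ring.
rewrite big_nat_recr //= subnn !expr0 !mulr1 addrA.
have ->: 2 * b ^+ n.+1 * c ^+ n.+1 + \sum_(1 <= j < n.+1)
     (c ^+ j + b ^+ j) ^+ 2 * b ^+ (n.+1 - j) * c ^+ (n.+1 - j) =
   b * c * (2 * b ^+ n * c ^+ n + \sum_(1 <= j < n.+1)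
     (c ^+ j + b ^+ j) ^+ 2 * b ^+ (n - j) * c ^+ (n - j)).
  rewrite mulrDr; congr (_ + _); first by rewrite !exprS; ring.
  rewrite mulr_sumr; apply: eq_big_nat => j /andP[_ ltjn].
  by rewrite subSn // !exprS; ring.
rewrite IHn mulnS add2n [in RHS]big_nat_recl // [in RHS]big_nat_recr //= subnn subn0.
under [in RHS]eq_big_nat => j /andP[_ ltj] do
  rewrite subSS subSn // !exprS mulrACA [c * b]mulrC.
rewrite -mulr_sumr !exprS mul2n -addnn !exprD !natrD; ring.
Qed.

End ClosedForms.

Unset Implicit Arguments.

Theorem theorem4p4 (R : realType) (a b : R[i]) (g : fps R[i])
  (hg : fps_inv_sqrt
          (fps_of_poly ((1 - a%:P * 'X) ^+ 2 - (4 * b)%:P * 'X)) g)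
  (n : nat) (hn : (0 < n)%N) :
  [/\ hankel_det g 0 n = 2 ^+ (n - 1) * b ^+ 'C(n, 2) * (a + b) ^+ 'C(n, 2),
      hankel_det g 1 n =
        2 ^+ (n - 1) * b ^+ 'C(n, 2) * (a + b) ^+ 'C(n, 2)
        * ((a + b) ^+ n + b ^+ n),
      hankel_det g 2 n =
        hankel_det g 0 n
        * (2 * b ^+ n * (a + b) ^+ n
           + \sum_(1 <= j < n.+1)
               ((a + b) ^+ j + b ^+ j) ^+ 2
               * b ^+ (n - j) * (a + b) ^+ (n - j))
    & hankel_det g 0 n
        * (2 * b ^+ n * (a + b) ^+ n
           + \sum_(1 <= j < n.+1)
               ((a + b) ^+ j + b ^+ j) ^+ 2
               * b ^+ (n - j) * (a + b) ^+ (n - j))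
      = hankel_det g 0 n
        * (\sum_(0 <= j < (2 * n).+1) (a + b) ^+ j * b ^+ (2 * n - j)
           + (2 * n + 1)%:R * b ^+ n * (a + b) ^+ n)].
Proof.
case: n hn => // n _; rewrite subn1 /=.
(* The coefficient of $z$ forces $s = a + 2b$, and that of $z^2$ then gives $4t = s^2 - a^2 = 4b(a +
   b)$. *)
have eq_radicand : (1 - a%:P * 'X) ^+ 2 - (4 * b)%:P * 'X =
    (1 - (b + (a + b))%:P * 'X) ^+ 2 - (4 * (b * (a + b)))%:P * 'X ^+ 2.
  by rewrite !rmorphM !rmorphD; ring.
rewrite eq_radicand in hg; have /funext-> := jcoef_inv_sqrt hg.
rewrite hankel_jcoef0 hankel_jcoef1 hankel_jcoef2 prod_jnorm_tau2.
rewrite det_jacobi_tau2 det_jacobi2_tau2 exprMn mulrA.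
by split=> //; [exact: mulrC | exact: mulrC | rewrite sum_sqr_power_sums].
Qed.
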